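(* Let $V$ be a locally linearly compact vector space over a discrete field $\mathbb K$, let $\phi\colon V\to V$ be a continuous endomorphism, let $W$ be a $\phi$-invariant (i.e. $\phi W\leq W$) closed linear subspace of $V$, and let $\overline\phi\colon V/W\to V/W$ be the continuous endomorphism induced by $\phi$. Then: (a) $\mathrm{ent}(\phi)\geq\mathrm{ent}(\phi\restriction_W)$; (b) $\mathrm{ent}(\phi)\geq\mathrm{ent}(\overline\phi)$.
   Context: $\mathbb K$ is an arbitrary field endowed with the discrete topology. A topological vector space over $\mathbb K$ is linearly topologized if it is Hausdorff and has a neighborhood basis at $0$ consisting of linear subspaces. A linear variety of $V$ is a coset $v+W$ of a linear subspace $W$; it is closed (open) if $W$ is closed (open). A linearly topologized vector space is linearly compact if every collection of closed linear varieties with the finite intersection property has non-empty intersection. A linearly topologized vector space is locally linearly compact (l.l.c.) if it has an open linear subspace that is linearly compact; $\mathcal B(V)$ denotes the family of all linearly compact open linear subspaces of $V$. A closed linear subspace $W$ of an l.l.c. space (with the induced topology) and the quotient $V/W$ (with the quotient topology) are l.l.c. ''Endomorphism'' means linear endomorphism. For a continuous endomorphism $\phi$ of an l.l.c. space $V$, $U\in\mathcal B(V)$ and a positive integer $n$, let $T_n(\phi,U)=U+\phi U+\dots+\phi^{n-1}U$. Define $H(\phi,U)=\lim_{n\to\infty}\frac1n\dim\frac{T_n(\phi,U)}{U}$ (the limit exists) and $\mathrm{ent}(\phi)=\sup\{H(\phi,U)\mid U\in\mathcal B(V)\}\in\mathbb N\cup\{\infty\}$. *)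

(* Defs.v *)
From HB Require Import structures.
From mathcomp Require Import all_boot all_order all_algebra.
From mathcomp Require Import all_classical all_reals.
From mathcomp Require Import topology ereal.

Set Implicit Arguments.
Unset Strict Implicit.
Unset Printing Implicit Defensive.

Import Order.TTheory GRing.Theory Num.Theory.

Local Open Scope classical_set_scope.
Local Open Scope ring_scope.
Local Open Scope quotient_scope.

(* The structures of tvs.v require scalars in a numDomainType with its norm
   topology and admit no join with modules over an arbitrary field, hence this
   independent structure, whose scalars are discrete.  Declaring it fails if
   normedtype is already loaded; loading normedtype afterwards is harmless. *)
HB.mixin Record isDiscreteTvs (K : fieldType) V
    & Topological V & GRing.Lmodule K V := {
  dtvs_add_continuous : continuous (fun x : V * V => x.1 + x.2) ;
  dtvs_scale_continuous :
    continuous (fun z : discrete_topology K * V => (z.1 : K) *: z.2)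
}.

#[short(type="discreteTvsType")]
HB.structure Definition DiscreteTvs (K : fieldType) :=
  {V of Topological V & GRing.Lmodule K V & isDiscreteTvs K V}.

Record linearSubspace (K : fieldType) (V : lmodType K) := LinearSubspace {
  subspace_pred :> {pred V} ;
  subspace_closed : GRing.submod_closed subspace_pred
}.

HB.instance Definition _ (K : fieldType) (V : lmodType K)
    (W : linearSubspace V) :=
  GRing.isSubmodClosed.Build K V (subspace_pred W) (subspace_closed W).

Section Subspace.
Variables (K : fieldType) (V : discreteTvsType K) (W : linearSubspace V).

Definition subsp : Type := {v : V | v \in W}.

HB.instance Definition _ := SubType.on subsp.
HB.instance Definition _ := [Choice of subsp by <:].
HB.instance Definition _ := [SubChoice_isSubLmodule of subsp by <:].
HB.instance Definition _ :=
  Topological.copy subsp (initial_topology (val : subsp -> V)).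

Lemma subsp_val_continuous : continuous (val : subsp -> V).
Proof. exact: initial_continuous. Qed.

Lemma subsp_continuousP (T : topologicalType) (f : T -> subsp) :
  continuous (val \o f) -> continuous f.
Proof.
move=> /continuousP cf; apply/continuousP => _ [A oA <-].
by rewrite -comp_preimage; exact: cf.
Qed.

Lemma subsp_add_continuous : continuous (fun x : subsp * subsp => x.1 + x.2).
Proof.
apply: subsp_continuousP => x.
apply: (@continuous_comp _ _ _ (fun x : subsp * subsp => (val x.1, val x.2))
  (fun x : V * V => x.1 + x.2)); last exact: dtvs_add_continuous.
by apply: cvg_pair; apply: continuous_comp;
  [exact: cvg_fst|exact: subsp_val_continuous
  |exact: cvg_snd|exact: subsp_val_continuous].
Qed.

Lemma subsp_scale_continuous :
  continuous (fun z : discrete_topology K * subsp => (z.1 : K) *: z.2).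
Proof.
apply: subsp_continuousP => x.
pose f (z : discrete_topology K * subsp) : discrete_topology K * V :=
  (z.1, val z.2).
have cf : {for x, continuous f}.
  apply: (@cvg_pair _ _ _ (nbhs x) (nbhs x.1) (nbhs (val x.2))).
    exact: cvg_fst.
  by apply: continuous_comp; [exact: cvg_snd|exact: subsp_val_continuous].
exact: continuous_comp cf (@dtvs_scale_continuous K V (f x)).
Qed.

HB.instance Definition _ :=
  isDiscreteTvs.Build K subsp subsp_add_continuous subsp_scale_continuous.

End Subspace.

Section QuotientSpace.
Variables (K : fieldType) (V : discreteTvsType K) (W : linearSubspace V).

Definition quotsp : Type := @Quotient.quot V W.

HB.instance Definition _ := Quotient.on quotsp.
HB.instance Definition _ := GRing.Zmodule.copy quotsp (@Quotient.quot V W).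

Definition quot_pi (v : V) : quotsp := \pi_(@Quotient.quot V W) v.

Lemma quot_pi_repr (x : quotsp) : quot_pi (repr x) = x.
Proof. exact: reprK. Qed.

Lemma quot_piP u v : quot_pi u = quot_pi v <-> u - v \in W.
Proof. by rewrite (@Quotient.idealrBE V W); split => [uv|/eqP//]; exact/eqP. Qed.

Lemma quot_piD u v : quot_pi (u + v) = quot_pi u + quot_pi v.
Proof. exact: (@Quotient.pi_add V W). Qed.

Definition quot_scale (a : K) (x : quotsp) : quotsp := quot_pi (a *: repr x).

Lemma quot_piZ a v : quot_pi (a *: v) = quot_scale a (quot_pi v).
Proof.
apply/quot_piP; rewrite -scalerBr rpredZ//.
by apply/quot_piP; rewrite quot_pi_repr.
Qed.

Lemma quot_scaleA a b x :
  quot_scale a (quot_scale b x) = quot_scale (a * b) x.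
Proof. by rewrite -[x]quot_pi_repr -!quot_piZ scalerA. Qed.

Lemma quot_scale1 : left_id 1 quot_scale.
Proof. by move=> x; rewrite -[x]quot_pi_repr -!quot_piZ scale1r. Qed.

Lemma quot_scaleDr : right_distributive quot_scale +%R.
Proof.
move=> a x y; rewrite -[x]quot_pi_repr -[y]quot_pi_repr.
by rewrite -quot_piD -!quot_piZ scalerDr quot_piD.
Qed.

Lemma quot_scaleDl x : {morph quot_scale^~ x : a b / a + b}.
Proof.
move=> a b; rewrite -[x]quot_pi_repr.
by rewrite -!quot_piZ scalerDl quot_piD.
Qed.

HB.instance Definition _ := GRing.Zmodule_isLmodule.Build K quotsp
  quot_scaleA quot_scale1 quot_scaleDr quot_scaleDl.

Lemma quot_pi_is_linear : linear quot_pi.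
Proof. by move=> a u v; rewrite quot_piD quot_piZ. Qed.

HB.instance Definition _ :=
  GRing.isLinear.Build K V quotsp *:%R quot_pi quot_pi_is_linear.

(* The library's quotient_topology comes with a choice structure different from
   the one underlying the Zmodule structure of Quotient.quot. *)
Definition quotsp_open (A : set quotsp) := open (quot_pi @^-1` A).

Let quotsp_openT : quotsp_open setT. Proof. exact: openT. Qed.

Let quotsp_openI : setI_closed quotsp_open.
Proof. by move=> A B oA oB; exact: openI. Qed.

Let quotsp_open_bigU (I : Type) (F : I -> set quotsp) :
  (forall i, quotsp_open (F i)) -> quotsp_open (\bigcup_i F i).
Proof. by move=> oF; apply: bigcup_open => i _; exact: oF. Qed.

HB.instance Definition _ :=
  isOpenTopological.Build quotsp quotsp_openT quotsp_openI quotsp_open_bigU.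

Lemma quot_pi_continuous : continuous quot_pi.
Proof. exact/continuousP. Qed.

Lemma dtvs_translate_continuous (u : V) : continuous (fun v : V => v + u).
Proof.
move=> x; apply: (@continuous_comp _ _ _ (fun v : V => (v, u))
  (fun z : V * V => z.1 + z.2)); last exact: dtvs_add_continuous.
by apply: cvg_pair; [exact: cvg_id|exact: cvg_cst].
Qed.

Lemma quot_pi_open (A : set V) : open A -> open (quot_pi @` A).
Proof.
move=> oA; rewrite /open/= /quotsp_open.
rewrite (_ : _ @^-1` _ = \bigcup_(w in [set w | w \in W]) [set v | A (v + w)]).
  apply: bigcup_open => w _.
  by move/continuousP: (@dtvs_translate_continuous w); apply.
rewrite eqEsubset; split=> v /=.
  case=> u Au /quot_piP uvW; exists (u - v) => //=.
  by rewrite addrC subrK.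
case=> w /= wW Avw; exists (v + w) => //; apply/quot_piP.
by rewrite addrAC subrr add0r.
Qed.

Lemma quot_pi_nbhs (v : V) (A : set V) :
  nbhs v A -> nbhs (quot_pi v) (quot_pi @` A).
Proof.
rewrite nbhsE => -[B [oB Bv] BA].
apply: (@filterS _ _ _ (quot_pi @` B)); first exact: image_subset.
by apply: open_nbhs_nbhs; split; [exact: quot_pi_open|exists v].
Qed.

Lemma quotsp_add_continuous : continuous (fun x : quotsp * quotsp => x.1 + x.2).
Proof.
move=> [x y] B; rewrite -[x]quot_pi_repr -[y]quot_pi_repr/= -quot_piD.
move=> /quot_pi_continuous /(@dtvs_add_continuous K V (repr x, repr y)).
move=> [[P Q] /= [nP nQ] PQB].
exists (quot_pi @` P, quot_pi @` Q) => /=.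
  by split; exact: quot_pi_nbhs.
move=> [_ _] /= [[p Pp <-] [q Qq <-]].
by rewrite /= -quot_piD; exact: (PQB (p, q)).
Qed.

Lemma quotsp_scale_continuous :
  continuous (fun z : discrete_topology K * quotsp => (z.1 : K) *: z.2).
Proof.
move=> [a x] B; rewrite -[x]quot_pi_repr/= -linearZ/=.
move=> /quot_pi_continuous.
move=> /(@dtvs_scale_continuous K V (a : discrete_topology K, repr x)).
move=> [[P Q] /= [nP nQ] PQB].
exists (P, quot_pi @` Q) => /=; first by split => //; exact: quot_pi_nbhs.
move=> [b _] /= [Pb [q Qq <-]].
by rewrite /= -linearZ; exact: (PQB (b, q)).
Qed.

HB.instance Definition _ :=
  isDiscreteTvs.Build K quotsp quotsp_add_continuous quotsp_scale_continuous.

End QuotientSpace.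

Section LinearlyCompact.
Variables (K : fieldType).
Implicit Types V : discreteTvsType K.

Definition linearly_topologized V : Prop :=
  hausdorff_space V /\
  forall A : set V, nbhs 0 A ->
    exists2 U : linearSubspace V, nbhs 0 [set` U] & [set` U] `<=` A.

Definition closed_linear_variety V : set (set V) :=
  [set A | exists2 W : linearSubspace V, closed [set` W] &
           exists v, A = [set v + w | w in [set` W]]].

Definition linearly_compact V : Prop :=
  linearly_topologized V /\
  forall D : set (set V), D `<=` @closed_linear_variety V -> finI D id ->
    \bigcap_(A in D) A !=set0.

Definition lc_open_subspaces V : set (linearSubspace V) :=
  [set U : linearSubspace V | open [set` U] /\ linearly_compact (subsp U)].

Definition locally_linearly_compact V : Prop :=
  linearly_topologized V /\ @lc_open_subspaces V !=set0.

End LinearlyCompact.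

Section Dimension.
Variables (R : realType) (K : fieldType) (E : lmodType K).

Definition is_basis (A : set E) n (b : 'I_n -> E) :=
  (forall i, A (b i)) /\
  forall v, A v -> exists! c : 'rV[K]_n, v = \sum_i c 0 i *: b i.

(* meant for linear subspaces A *)
Definition vdim (A : set E) : \bar R :=
  xget +oo%E [set n%:R%:E | n in [set n | exists b : 'I_n -> E, is_basis A b]].

End Dimension.

Section Entropy.
Variables (R : realType) (K : fieldType) (V : discreteTvsType K).
Implicit Types (phi : {linear V -> V}) (U : linearSubspace V).

(* U + phi U + ... + phi^(n-1) U *)
Definition trajectory phi U n : set V :=
  [set v | exists2 u : 'I_n -> V, forall i, u i \in U &
           v = \sum_(i < n) iter i phi (u i)].

(* T_n / U is the image of T_n in V / U *)
Definition H_ent phi U : \bar R :=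
  limn (fun n => (n%:R^-1)%:E * vdim R (@quot_pi K V U @` trajectory phi U n))%E.

Definition ent phi : \bar R :=
  ereal_sup [set H_ent phi U | U in @lc_open_subspaces K V].

End Entropy.

Definition invariant_subspace (K : fieldType) (V : lmodType K)
    (phi : V -> V) (W : linearSubspace V) : Prop :=
  forall w, w \in W -> phi w \in W.

Section InducedEndomorphisms.
Variables (K : fieldType) (V : discreteTvsType K) (W : linearSubspace V).
Variables (phi : {linear V -> V}) (phiW : invariant_subspace phi W).

Definition restr_endo (w : subsp W) : subsp W :=
  Sub (phi (val w)) (phiW (valP w)).

Lemma restr_endo_is_linear : linear restr_endo.
Proof. by move=> a u v; apply: val_inj; rewrite /= linearP. Qed.

HB.instance Definition _ := GRing.isLinear.Build K (subsp W) (subsp W) *:%R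
  restr_endo restr_endo_is_linear.

Lemma restr_endo_continuous : continuous phi -> continuous restr_endo.
Proof.
move=> cphi; apply: subsp_continuousP => x.
apply: (@continuous_comp _ _ _ (val : subsp W -> V) phi); last exact: cphi.
exact: subsp_val_continuous.
Qed.

(* phiW is not needed to define the function, only for the equation
   quot_endo_pi and for linearity. *)
Definition quot_endo of invariant_subspace phi W :=
  fun x : quotsp W => quot_pi W (phi (repr x)).

Lemma quot_endo_pi v : quot_endo phiW (quot_pi W v) = quot_pi W (phi v).
Proof.
apply/quot_piP; rewrite -linearB; apply: phiW.
by apply/quot_piP; rewrite quot_pi_repr.
Qed.

Lemma quot_endo_is_linear : linear (quot_endo phiW).
Proof.
move=> a x y; rewrite -[x]quot_pi_repr -[y]quot_pi_repr.
by rewrite -linearP !quot_endo_pi -linearP -linearP.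
Qed.

HB.instance Definition _ := GRing.isLinear.Build K (quotsp W) (quotsp W) *:%R
  (quot_endo phiW) quot_endo_is_linear.

Lemma quot_endo_continuous : continuous phi -> continuous (quot_endo phiW).
Proof.
move=> cphi; apply/continuousP => A oA.
rewrite /open/= /quotsp_open -comp_preimage.
rewrite (_ : _ \o _ = quot_pi W \o phi); last first.
  by apply/funext => v; exact: quot_endo_pi.
have /continuousP : continuous (quot_pi W \o phi); last by apply.
move=> v; apply: continuous_comp; [exact: cphi|exact: quot_pi_continuous].
Qed.

End InducedEndomorphisms.

(* Main.v *)
From HB Require Import structures.
Require Import Defs.
From mathcomp Require Import all_boot all_order all_algebra finmap.
From mathcomp Require Import all_classical all_reals.
From mathcomp Require Import topology normedtype sequences ereal.

Set Implicit Arguments.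
Unset Strict Implicit.
Unset Printing Implicit Defensive.

Import Order.TTheory GRing.Theory Num.Theory numFieldNormedType.Exports.
Local Open Scope classical_set_scope.
Local Open Scope ring_scope.

(* An open subspace of a linearly compact space has finite codimension; hence
   T_2 / U is finite dimensional.  Since phi maps T_(n+1) / T_n onto
   T_(n+2) / T_(n+1), these steps have nonincreasing finite dimensions, and the
   limit H(phi, U) exists as a limit of Cesaro means.
   (a) Given U' in B(W), take L in B(V) with L meeting W inside U', and let
   U = L + U'.  As U' is the sum of its intersection with L and a
   finite-dimensional space, U is in B(V); it meets W exactly in U', so that
   T_n(phi|W, U') / U' embeds in T_n(phi, U) / U.
   (b) Given U' in B(V/W) and U0 in B(V), the intersection of U0 with the
   preimage of U' maps onto an open subspace of U'; adding lifts of finitely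
   many vectors gives U in B(V) with image U', and T_n(phi, U) / U maps onto
   T_n(phibar, U') / U'. *)

(** * Subspaces of a vector space and bases of their quotients *)

Section SubspaceConstructions.
Variables (K : fieldType) (V : lmodType K).

Definition submod_set (S : set V) :=
  S 0 /\ forall a u v, S u -> S v -> S (a *: u + v).

Lemma submod_set_closed (S : set V) :
  submod_set S -> GRing.submod_closed (mem S).
Proof.
move=> [S0 SD]; split; first by rewrite unfold_in/= inE.
by move=> a u v; rewrite !unfold_in/= !inE; exact: SD.
Qed.

(** Locked, so that membership is unfolded only through [in_subspace_of]. *)
Definition subspace_of (S : set V) (hS : submod_set S) : linearSubspace V :=
  locked (LinearSubspace (submod_set_closed hS)).

Lemma in_subspace_of (S : set V) (hS : submod_set S) v :
  v \in subspace_of hS <-> S v.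
Proof. by rewrite /subspace_of -lock -(in_setE S v). Qed.

Definition lincomb n (b : 'I_n -> V) (c : 'rV[K]_n) : V :=
  \sum_i c 0 i *: b i.

Lemma lincomb_is_linear n (b : 'I_n -> V) : linear (lincomb b).
Proof.
move=> a c d; rewrite /lincomb scaler_sumr -big_split/=.
by apply: eq_bigr => i _; rewrite !mxE scalerDl scalerA.
Qed.

HB.instance Definition _ n (b : 'I_n -> V) :=
  GRing.isLinear.Build K 'rV[K]_n V *:%R (lincomb b) (lincomb_is_linear b).

Lemma lincomb_in (Z : linearSubspace V) n (b : 'I_n -> V) c :
  (forall i, b i \in Z) -> lincomb b c \in Z.
Proof. by move=> bZ; apply: rpred_sum => i _; exact: rpredZ. Qed.

Lemma lincomb_delta n (b : 'I_n -> V) i : lincomb b (delta_mx 0 i) = b i.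
Proof.
rewrite /lincomb (bigD1 i)//= big1 => [|j ji]; last first.
  by rewrite mxE eqxx (negbTE ji) scale0r.
by rewrite mxE !eqxx scale1r addr0.
Qed.

(* free_mod, spans_mod and basis_mod describe bases of quotients B / A by
   representatives in the ambient space. *)
Definition free_mod (A : linearSubspace V) n (b : 'I_n -> V) :=
  forall c, lincomb b c \in A -> c = 0.

Definition spans_mod (A B : linearSubspace V) n (b : 'I_n -> V) :=
  forall v, v \in B -> exists c, v - lincomb b c \in A.

Definition basis_mod (A B : linearSubspace V) n (b : 'I_n -> V) :=
  [/\ forall i, b i \in B, free_mod A b & spans_mod A B b].

(** If [m < n], the matrix of coordinates of [b] in terms of [b'] modulo [A] has a nonzero left
    kernel vector, which is a relation among the [b i] modulo [A]. *)
Lemma free_mod_leq (A B : linearSubspace V) n m (b : 'I_n -> V)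
    (b' : 'I_m -> V) :
  (forall i, b i \in B) -> free_mod A b -> spans_mod A B b' ->
  (n <= m)%N.
Proof.
move=> bB bfree b'span; rewrite leqNgt; apply/negP => mn.
have /choice[c cP] : forall i, exists c, b i - lincomb b' c \in A.
  by move=> i; exact: b'span.
pose M : 'M[K]_(n, m) := \matrix_(i, j) c i 0 j.
have : kermx M != 0.
  rewrite -mxrank_eq0 mxrank_ker -lt0n subn_gt0.
  exact: leq_ltn_trans (rank_leq_col M) mn.
case/rowV0Pn => v /sub_kermxP vM /negP; apply; apply/eqP/bfree.
have -> : lincomb b v = \sum_i v 0 i *: (b i - lincomb b' (c i)).
  have : lincomb b' (v *m M) = 0 by rewrite vM linear0.
  rewrite mulmx_sum_row linear_sum/= => vM0.
  rewrite -[LHS]subr0 -[in LHS]vM0 /(lincomb b v) -sumrB; apply: eq_bigr => i _.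
  rewrite scalerBr linearZ/=; congr (_ - _ *: lincomb b' _).
  by apply/rowP => j; rewrite !mxE.
by apply: rpred_sum => i _; exact: rpredZ.
Qed.

Lemma basis_mod_uniq (A B : linearSubspace V) n m (b : 'I_n -> V)
    (b' : 'I_m -> V) :
  basis_mod A B b -> basis_mod A B b' -> n = m.
Proof.
move=> [bB bf bs] [b'B b'f b's]; apply/eqP; rewrite eqn_leq.
by rewrite (free_mod_leq bB bf b's) (free_mod_leq b'B b'f bs).
Qed.

(** In a relation with nonzero coefficient at [v], dividing by it would put [v] in the span of [b]
    modulo [A]. *)
Lemma free_mod_extend (A : linearSubspace V) n (b : 'I_n -> V) v :
  free_mod A b -> (forall c, v - lincomb b c \notin A) ->
  free_mod A (fun i => if unlift ord0 i is Some j then b j else v).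
Proof.
move=> bf vb c; set b' := fun i => _.
pose d : 'rV[K]_n := \row_j c 0 (lift ord0 j).
have -> : lincomb b' c = c 0 0 *: v + lincomb b d.
  rewrite /lincomb big_ord_recl /b' unlift_none; congr (_ + _).
  by apply: eq_bigr => j _; rewrite liftK mxE.
have [c0|c0] := eqVneq (c 0 0) 0.
  rewrite c0 scale0r add0r => /bf d0.
  apply/rowP => i; case: (unliftP ord0 i) => [j ->|->]; rewrite ?mxE//.
  by move/rowP : d0 => /(_ j); rewrite !mxE.
move=> cA; have /negP[] := vb (- (c 0 0)^-1 *: d).
rewrite linearZ/= scaleNr opprK.
have : (c 0 0)^-1 *: (c 0 0 *: v + lincomb b d) \in A by exact: rpredZ.
by rewrite scalerDr scalerA mulVf// scale1r.
Qed.

(** A free family of maximal size spans; [free_mod_leq] bounds the sizes by [m]. *)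
Lemma basis_mod_ex (A B : linearSubspace V) m (b' : 'I_m -> V) :
  spans_mod A B b' -> exists2 n, (n <= m)%N &
  exists b : 'I_n -> V, basis_mod A B b.
Proof.
move=> b's.
pose P n := `[< exists2 b : 'I_n -> V, forall i, b i \in B & free_mod A b >].
have P0 : exists n, P n.
  exists 0%N; apply/asboolP; exists (fun=> 0) => [i|c _]; first exact: rpred0.
  by apply/rowP => -[].
have Pm n : P n -> (n <= m)%N.
  by move=> /asboolP[b bB bf]; exact: free_mod_leq bB bf b's.
case: (ex_maxnP P0 Pm) => n Pn nmax; exists n; first exact: Pm.
move/asboolP : Pn => [b bB bf]; exists b; split=> // v vB.
apply: contrapT => /forallNP vb.
suff /nmax : P n.+1 by rewrite ltnn.
apply/asboolP; exists (fun i => if unlift ord0 i is Some j then b j else v).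
  by move=> i; case: unlift.
by apply: free_mod_extend => // c; apply/negP; exact: vb.
Qed.

(** Yields dim C/A = dim B/A + dim C/B. *)
Lemma basis_mod_cat (A B C : linearSubspace V) n m (b : 'I_n -> V)
    (b' : 'I_m -> V) :
  {subset A <= B} -> {subset B <= C} ->
  basis_mod A B b -> basis_mod B C b' ->
  basis_mod A C
    (fun i => match fintype.split i with inl j => b j | inr j => b' j end).
Proof.
move=> AB BC [bB bf bs] [b'C b'f b's]; set b2 := fun i => _.
have b2E c d : lincomb b2 (row_mx c d) = lincomb b c + lincomb b' d.
  rewrite /lincomb big_split_ord/=; congr (_ + _); apply: eq_bigr => i _.
    by rewrite row_mxEl /b2 (unsplitK (inl i : 'I_n + 'I_m)).
  by rewrite row_mxEr /b2 (unsplitK (inr i : 'I_n + 'I_m)).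
split.
- by move=> i; rewrite /b2; case: fintype.split => j//; exact: BC.
- move=> c; rewrite -[c]hsubmxK b2E => cA.
  have r0 : rsubmx c = 0.
    apply: b'f; rewrite -[lincomb b' _](addKr (lincomb b (lsubmx c))).
    by rewrite rpredD ?rpredN ?lincomb_in//; exact: AB.
  rewrite r0 linear0 addr0 in cA.
  by rewrite (bf _ cA) r0 row_mx0.
- move=> v /b's[d dB]; have [c cA] := bs _ dB.
  by exists (row_mx c d); rewrite b2E opprD addrA addrAC.
Qed.

End SubspaceConstructions.

Lemma linear_lincomb (K : fieldType) (V V' : lmodType K) (f : {linear V -> V'})
    n (b : 'I_n -> V) c :
  f (lincomb b c) = lincomb (fun i => f (b i)) c.
Proof. by rewrite linear_sum; apply: eq_bigr => i _; rewrite linearZ. Qed.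

(** * Dimension of T/U computed with representatives *)

Section QuotientDimension.
Variables (R : realType) (K : fieldType) (V : discreteTvsType K).
Implicit Types U T : linearSubspace V.

Lemma quot_pi0P U v : quot_pi U v = 0 <-> v \in U.
Proof. by have := quot_piP U v 0; rewrite linear0 subr0. Qed.

Lemma basis_mod_quot U T n (b : 'I_n -> V) :
  basis_mod U T b ->
  is_basis (quot_pi U @` [set` T]) (fun i => quot_pi U (b i)).
Proof.
move=> [bT bf bs]; split=> [i|_ [v /= vT <-]]; first by exists (b i) => //=.
have [c cU] := bs _ vT.
exists c; split=> [|d]; first by rewrite -[RHS]linear_lincomb; exact/quot_piP.
rewrite -[RHS]linear_lincomb => /quot_piP dU.
apply/eqP; rewrite -subr_eq0; apply/eqP/bf; rewrite linearB/=.
have -> : lincomb b c - lincomb b d = (v - lincomb b d) - (v - lincomb b c).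
  by rewrite opprB [RHS]addrC addrA subrK.
exact: rpredB.
Qed.

Lemma quot_basis_mod U T n (b : 'I_n -> quotsp U) :
  {subset U <= T} -> is_basis (quot_pi U @` [set` T]) b ->
  basis_mod U T (fun i => repr (b i)).
Proof.
move=> UT [bT buniq].
have br i : quot_pi U (repr (b i)) = b i by exact: quot_pi_repr.
have rE c : quot_pi U (lincomb (fun i => repr (b i)) c) = \sum_i c 0 i *: b i.
  by rewrite linear_lincomb; apply: eq_bigr => i _ /=; rewrite br.
split=> [i|c cU|v vT].
- have [v /= vT vE] := bT i.
  (* The chosen representative differs from [v], which is in [T], by an element of [U]. *)
  rewrite -[repr _](subrK v) rpredD//; apply: UT.
  by apply/quot_piP; rewrite br.
- have [|c0 [_ c0E]] := buniq 0.
    by exists 0 => /=; [exact: rpred0|rewrite linear0].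
  have <- : c0 = c by apply: c0E; rewrite -rE; apply/esym/quot_pi0P.
  by apply: c0E; rewrite big1// => i _; rewrite mxE scale0r.
- have [|c [cE _]] := buniq (quot_pi U v); first by exists v.
  by exists c; apply/quot_piP; rewrite rE.
Qed.

Lemma vdim_quot U T n (b : 'I_n -> V) :
  {subset U <= T} -> basis_mod U T b ->
  vdim R (quot_pi U @` [set` T]) = n%:R%:E.
Proof.
move=> UT hb; rewrite /vdim; set S := [set n | _]; set D := image _ _.
(* The basis [b] shows that [D] is inhabited, so [xget] does not return its default; whatever it
   picks is the size of a basis. *)
have : D (xget +oo%E D).
  apply: xgetPex; exists n%:R%:E, n => //=.
  by eexists; exact: basis_mod_quot hb.
move=> [m [b' /(quot_basis_mod UT) hb'] <-].
by rewrite (basis_mod_uniq hb hb').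
Qed.

End QuotientDimension.

(** * Trajectories T_n(phi, U) and their successive quotients *)

Section Trajectory.
Variables (K : fieldType) (V : discreteTvsType K).
Variables (phi : {linear V -> V}) (U : linearSubspace V).

Lemma iter_linearP i a u v :
  iter i phi (a *: u + v) = a *: iter i phi u + iter i phi v.
Proof. by elim: i => //= i ->; rewrite linearP. Qed.

Lemma trajectory_submod n : submod_set (trajectory phi U n).
Proof.
split=> [|a _ _ [u uU ->] [v vU ->]].
  exists (fun=> 0) => [i|]; first exact: rpred0.
  rewrite big1// => i _; by elim: (i : nat) => //= k ->; rewrite linear0.
exists (fun i => a *: u i + v i) => [i|]; first by rewrite rpredD// rpredZ.
rewrite scaler_sumr -big_split; apply: eq_bigr => i _.
by rewrite iter_linearP.
Qed.

Definition traj n : linearSubspace V := subspace_of (trajectory_submod n).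

Lemma trajP n v : v \in traj n <-> trajectory phi U n v.
Proof. exact: in_subspace_of. Qed.

Lemma trajE n : [set` traj n] = trajectory phi U n.
Proof. by apply/seteqP; split => v /= /trajP. Qed.

(** The recursion T_(n+1) = U + phi T_n, on which the inductions on trajectories rest. *)
Lemma trajS n v :
  v \in traj n.+1 <-> exists u w, [/\ u \in U, w \in traj n & v = u + phi w].
Proof.
rewrite trajP; split.
  move=> [u uU ->].
  exists (u ord0), (\sum_(i < n) iter i phi (u (lift ord0 i))).
  split=> //; first by apply/trajP; exists (fun i => u (lift ord0 i)).
  by rewrite big_ord_recl linear_sum.
move=> [u [w [uU /trajP[w' w'U ->] ->]]].
exists (fun i => if unlift ord0 i is Some j then w' j else u).
  by move=> i; case: unlift.
rewrite big_ord_recl unlift_none linear_sum; congr (_ + _).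
by apply: eq_bigr => i _; rewrite liftK.
Qed.

Lemma sub_trajS n : {subset traj n <= traj n.+1}.
Proof.
elim: n => [|n IH] v.
  move=> /trajP[u _ ->]; rewrite big_ord0; exact: rpred0.
by move=> /trajS[u [w [uU /IH wT ->]]]; apply/trajS; exists u, w.
Qed.

Lemma traj1 v : v \in traj 1 <-> v \in U.
Proof.
split=> [/trajS[u [w [uU /trajP[x _ ->] ->]]]|vU].
  by rewrite big_ord0 linear0 addr0.
apply/trajS; exists v, 0; split=> //; first exact: rpred0.
by rewrite linear0 addr0.
Qed.

Lemma sub_traj n : {subset U <= traj n.+1}.
Proof.
elim: n => [|n IH] v vU; first exact/traj1.
by apply: sub_trajS; exact: IH.
Qed.

Lemma spans_mod_trajS n m (b : 'I_m -> V) :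
  spans_mod (traj n.+1) (traj n.+2) b ->
  spans_mod (traj n.+2) (traj n.+3) (fun i => phi (b i)).
Proof.
move=> bs v /trajS[u [w [uU /bs[c cT] ->]]]; exists c.
rewrite -linear_lincomb -addrA -linearB; apply/trajS.
by exists u, (w - lincomb b c).
Qed.

(** [d n] is the dimension of T_(n+2)/T_(n+1): the chain starts at T_1 = U, as T_0 = 0. The images
    under [phi] of a basis of one step span the next. *)
Lemma traj_steps m (b : 'I_m -> V) :
  spans_mod U (traj 2) b ->
  exists d : nat -> nat, (forall n, d n.+1 <= d n)%N /\
    forall n, exists b' : 'I_(d n) -> V, basis_mod (traj n.+1) (traj n.+2) b'.
Proof.
move=> bs.
have /choice[d dP] n : exists k,
    exists b' : 'I_k -> V, basis_mod (traj n.+1) (traj n.+2) b'.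
  elim: n => [|n [k [b' [_ _ /spans_mod_trajS/basis_mod_ex]]]]; last first.
    by case=> k' _; exists k'.
  have [v /bs[c cU]|k _] := @basis_mod_ex _ _ (traj 1) (traj 2) _ b.
    by exists c; exact/traj1.
  by exists k.
exists d; split=> // n; have [b1 hb1] := dP n; have [b2 hb2] := dP n.+1.
have [_ _ /spans_mod_trajS/basis_mod_ex[k kd [b3 hb3]]] := hb1.
by rewrite (basis_mod_uniq hb2 hb3).
Qed.

(** Concatenating bases of the first n steps gives a basis of T_(n+1)/U. *)
Lemma traj_basis (d : nat -> nat) :
  (forall n, exists b' : 'I_(d n) -> V, basis_mod (traj n.+1) (traj n.+2) b') ->
  forall n, exists b : 'I_(\sum_(i < n) d i) -> V, basis_mod U (traj n.+1) b.
Proof.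
move=> dP; elim=> [|n [b hb]].
  rewrite big_ord0; exists (fun=> 0); split=> [i|c _|v /traj1 vU].
  - exact: rpred0.
  - by apply/rowP => -[].
  - by exists 0; rewrite linear0 subr0.
have [b' hb'] := dP n; rewrite big_ord_recr/=; eexists.
by apply: basis_mod_cat hb hb'; [exact: sub_traj|exact: sub_trajS].
Qed.

End Trajectory.

(** * Convergence and comparison of the sequences defining H *)

Section Entropy.
Variables (R : realType) (K : fieldType).

Lemma cvg_mean_nonincreasing (d : nat -> nat) :
  (forall n, d n.+1 <= d n)%N ->
  cvgn (fun n => (n.+1%:R^-1 * (\sum_(i < n) d i)%:R : R)).
Proof.
(* The sum has n terms but the divisor is n+1; prepending 0 to [d] makes it a genuine Cesaro
   mean. *)
move=> d_ni; pose u n : R := if n is k.+1 then (d k)%:R else 0.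
have d_cvg : cvgn (fun n => (d n)%:R : R).
  apply: nonincreasing_is_cvgn; last by exists 0 => _ [n _ <-]; exact: ler0n.
  by apply/nonincreasing_seqP => n; rewrite ler_nat.
have u_cvg : u @ \oo --> limn (fun n => (d n)%:R : R) by rewrite -cvg_shiftS.
suff <- : arithmetic_mean u = (fun n => n.+1%:R^-1 * (\sum_(i < n) d i)%:R).
  by apply: cvgP; exact: cesaro u_cvg.
apply/funext => n; rewrite /arithmetic_mean seriesEnat/=; congr (_ * _).
by rewrite big_mkord big_ord_recl/= add0r natr_sum.
Qed.

Definition finite_step (V : discreteTvsType K) (phi : {linear V -> V}) U :=
  exists m, exists b : 'I_m -> V, spans_mod U (traj phi U 2) b.

Definition H_seq (V : discreteTvsType K) (phi : {linear V -> V}) U n : \bar R :=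
  ((n%:R^-1)%:E * vdim R (quot_pi U @` trajectory phi U n))%E.

Lemma H_seqS (V : discreteTvsType K) (phi : {linear V -> V}) U n k
    (b : 'I_k -> V) :
  basis_mod U (traj phi U n.+1) b -> H_seq phi U n.+1 = (n.+1%:R^-1 * k%:R)%:E.
Proof.
by move=> hb; rewrite /H_seq -trajE (vdim_quot R _ hb)//; exact: sub_traj.
Qed.

Lemma H_seq_cvg (V : discreteTvsType K) (phi : {linear V -> V}) U :
  finite_step phi U -> cvgn (H_seq phi U).
Proof.
move=> [m [b /traj_steps[d [d_ni /traj_basis dP]]]].
pose v n : R := n.+1%:R^-1 * (\sum_(i < n) d i)%:R.
apply: (cvgP (limn v)%:E); rewrite -cvg_shiftS.
rewrite (_ : mk_sequence _ = EFin \o v); last first.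
  by apply/funext => n; have [b' /H_seqS] := dP n.
by apply: cvg_EFin; [exact: nearW|exact: cvg_mean_nonincreasing].
Qed.

Lemma le_H_ent (V1 V2 : discreteTvsType K) (phi1 : {linear V1 -> V1})
    (phi2 : {linear V2 -> V2}) U1 U2 :
  finite_step phi1 U1 -> finite_step phi2 U2 ->
  (forall n n1 n2 (b1 : 'I_n1 -> V1) (b2 : 'I_n2 -> V2),
    basis_mod U1 (traj phi1 U1 n.+1) b1 ->
    basis_mod U2 (traj phi2 U2 n.+1) b2 -> (n1 <= n2)%N) ->
  (H_ent R phi1 U1 <= H_ent R phi2 U2)%E.
Proof.
move=> fs1 fs2 le12; apply: lee_lim; [exact: H_seq_cvg..|].
near=> n.
(* Bases are available for the trajectories of index k+1, which leaves out only the index 0. *)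
have -> : n = n.-1.+1 by rewrite prednK//; near: n; exact: nbhs_infty_gt.
have [m1 [? /traj_steps[d1 [_ /traj_basis/(_ n.-1)[b1 hb1]]]]] := fs1.
have [m2 [? /traj_steps[d2 [_ /traj_basis/(_ n.-1)[b2 hb2]]]]] := fs2.
have := H_seqS hb1; have := H_seqS hb2; rewrite /H_seq => -> ->.
rewrite lee_fin ler_wpM2l ?invr_ge0// ler_nat; exact: le12 hb1 hb2.
Unshelve. all: by end_near. Qed.

End Entropy.

(** * Open subspaces *)

Section OpenSubspaces.
Variables (K : fieldType) (V : discreteTvsType K).
Implicit Types U L Z : linearSubspace V.

Lemma translate_open (u : V) (A : set V) :
  open A -> open [set v | A (v + u)].
Proof. by move/continuousP: (@dtvs_translate_continuous K V u); apply. Qed.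

(** [L] is the union of the translates, by its own elements, of an open set inside it that contains
    0. *)
Lemma nbhs0_subspace_open L :
  nbhs 0 [set` L] -> open [set` L].
Proof.
rewrite nbhsE => -[A [oA A0] AL].
rewrite (_ : [set` L] = \bigcup_(u in [set` L]) [set v | A (v - u)]).
  by apply: bigcup_open => u _; exact: translate_open.
apply/seteqP; split=> [u /= uL|v [u /= uL /AL vuL]].
  by exists u => //=; rewrite subrr.
by rewrite -[v](subrK u); exact: rpredD.
Qed.

Lemma supspace_open L U :
  {subset L <= U} -> open [set` L] -> open [set` U].
Proof.
move=> LU oL; apply: nbhs0_subspace_open; apply: filterS (LU) _.
by apply: open_nbhs_nbhs; split=> //; exact: rpred0.
Qed.

(** The complement is a union of cosets of [U]. *)
Lemma open_subspace_closed U : open [set` U] -> closed [set` U].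
Proof.
move=> oU; rewrite -openC.
rewrite (_ : ~` _ = \bigcup_(u in ~` [set` U]) [set v | [set` U] (v - u)]).
  by apply: bigcup_open => u _; exact: translate_open.
apply/seteqP; split=> [u /= uU|v [u /= uU vuU] vU].
  by exists u => //=; rewrite subrr rpred0.
by apply: uU; rewrite -[u](subKr v) rpredB.
Qed.

End OpenSubspaces.

(** * Preimages and images of subspaces under linear maps *)

Section Preimage.
Variables (K : fieldType) (V V' : lmodType K) (f : {linear V -> V'}).

Lemma preim_submod (Z : linearSubspace V') : submod_set (f @^-1` [set` Z]).
Proof.
split=> [|a u v /= uZ vZ]; first by rewrite /= linear0 rpred0.
by rewrite /= linearP rpredD ?rpredZ.
Qed.

Definition preim_subspace (Z : linearSubspace V') : linearSubspace V :=
  subspace_of (preim_submod Z).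

Lemma in_preim_subspace Z v : (v \in preim_subspace Z) = (f v \in Z).
Proof.
by apply/idP/idP => [/in_subspace_of//|fv]; apply/in_subspace_of.
Qed.

Lemma preim_subspaceE Z : [set` preim_subspace Z] = f @^-1` [set` Z].
Proof. by apply/seteqP; split=> v /=; rewrite in_preim_subspace. Qed.

Lemma image_submod (Z : linearSubspace V) : submod_set (f @` [set` Z]).
Proof.
split=> [|a _ _ [u /= uZ <-] [v /= vZ <-]].
  by exists 0 => /=; [exact: rpred0|rewrite linear0].
by exists (a *: u + v); rewrite /= ?linearP// rpredD ?rpredZ.
Qed.

Definition image_subspace (Z : linearSubspace V) : linearSubspace V' :=
  subspace_of (image_submod Z).

Lemma in_image_subspace Z y :
  y \in image_subspace Z <-> exists2 x, x \in Z & f x = y.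
Proof. exact: in_subspace_of. Qed.

End Preimage.

(** Serves to pass from finitely many sets to finitely many indices naming them. *)
Lemma seq_choice (T I : eqType) (P : T -> I -> Prop) (s : seq T) :
  (forall x, x \in s -> exists i, P x i) ->
  exists F : seq I, forall x, x \in s -> exists2 i, i \in F & P x i.
Proof.
elim: s => [|y s IH] sP; first by exists [::].
have [x xs|F FP] := IH; first by apply: sP; rewrite inE xs orbT.
have [i iy] := sP y (mem_head _ _); exists (i :: F) => x.
rewrite inE => /predU1P[->|/FP[j jF jx]]; first by exists i; rewrite ?mem_head.
by exists j => //; rewrite inE jF orbT.
Qed.

(** * Linear compactness of subspaces, seen from the ambient space *)

Section LinearlyCompactSubspaces.
Variable K : fieldType.
Implicit Types V : discreteTvsType K.

(* Linear compactness of U expressed in the ambient space: the varieties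
   v i + Z i of V need not be contained in U. *)
Definition lc_subspace V (U : linearSubspace V) :=
  forall (I : choiceType) (v : I -> V) (Z : I -> linearSubspace V),
    (forall i, closed [set` Z i]) ->
    (forall F : seq I,
       exists2 x, x \in U & forall i, i \in F -> x - v i \in Z i) ->
    exists2 x, x \in U & forall i, x - v i \in Z i.

(** The traces on [U] of the varieties [v i + Z i] are closed linear varieties of [subsp U]. *)
Lemma lc_subspace_subsp V (U : linearSubspace V) :
  linearly_compact (subsp U) -> lc_subspace U.
Proof.
move=> [_ lc] I v Z Zc fip.
pose A i := [set w : subsp U | val w - v i \in Z i].
have [||w wA] := lc (range A).
(* The finite intersection property for the single index [i] provides a base point of the trace. *)
- move=> _ [i _ <-]; have [x xU xZ] := fip [:: i].
  have {}xZ : x - v i \in Z i by apply: xZ; rewrite inE.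
  exists (preim_subspace val (Z i)).
    rewrite preim_subspaceE.
    by move/continuous_closedP: (@subsp_val_continuous K V U); apply.
  exists (Sub x xU); apply/seteqP; split=> [w wA|w' /= [w]].
    exists (w - Sub x xU); last by rewrite addrC subrK.
    rewrite /= in_preim_subspace linearB/= -(subrKA (v i)).
    by rewrite rpredD// -opprB rpredN.
  rewrite in_preim_subspace => wZ <-; rewrite /A /mkset linearD/= addrAC.
  by rewrite rpredD.
- move=> D' D'A.
  have [B /D'A/set_mem[i _ iB]|F FP] :=
      @seq_choice _ _ (fun B i => A i = B) (enum_fset D').
    by exists i.
  have [x xU xF] := fip F; exists (Sub x xU) => B /= /FP[i iF <-].
  exact: xF.
- by exists (val w) => [|i]; [exact: valP|exact: wA (A i) (imageT A i)].
Qed.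

Lemma subsp_linearly_topologized V (U : linearSubspace V) :
  linearly_topologized V -> linearly_topologized (subsp U).
Proof.
move=> [hV bV]; split=> [p q pq|A].
  apply/val_inj/hV => A B /subsp_val_continuous nA /subsp_val_continuous nB.
  by have [w [wA wB]] := pq _ _ nA nB; exists (val w).
rewrite [in X in X -> _]nbhsE => -[_ [[B oB <-] B0] BA].
have [L nL LB] : exists2 L : linearSubspace V,
    nbhs 0 [set` L] & [set` L] `<=` B.
  by apply: bV; apply: open_nbhs_nbhs; split.
exists (preim_subspace val L); rewrite preim_subspaceE.
  exact: (@subsp_val_continuous K V U 0 _ nL).
by move=> w wL; apply: BA; exact: LB.
Qed.

(** As [U] is closed in [V], closed subspaces of [subsp U] have closed image in [V]. *)
Lemma subsp_lc_subspace V (U : linearSubspace V) :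
  linearly_topologized V -> closed [set` U] -> lc_subspace U ->
  linearly_compact (subsp U).
Proof.
move=> ltV cU lcU; split=> [|D Dclv fip].
  exact: subsp_linearly_topologized.
(* [D] is indexed by its own members; [p B] below holds the direction and a base point of [B],
   carried to [V]. *)
pose I : choiceType := {B : set (subsp U) | `[< D B >]}.
have /choice[p pP] (B : I) : exists p : linearSubspace V * V,
    closed [set` p.1] /\ forall w, val B w <-> val w - p.2 \in p.1.
  have /asboolP/Dclv[W cW [v BE]] := valP B.
  exists (image_subspace val W, val v); split=> [|w];
    rewrite [fst _]/= ?[snd _]/=.
    move: cW; rewrite -openC => -[O oO OW].
    rewrite (_ : [set` _] = [set` U] `&` ~` O).
      by apply: closedI => //; exact: open_closedC.
    apply/seteqP; split=> [_ /= /in_image_subspace[w wW <-]|x [/= xU xO]].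
      split; first exact: valP.
      by move=> Ow; have : (val @^-1` O) w by []; rewrite OW.
    apply/in_image_subspace; exists (Sub x xU) => //; apply: contrapT => xW.
    have : (~` [set` W]) (Sub x xU : subsp U) by [].
    by rewrite -OW.
  rewrite BE; split=> [[w' w'W <-]|/in_image_subspace[w' w'W w'E]].
    apply/in_image_subspace; exists w' => //.
    by rewrite linearD/= addrC addKr.
  exists w' => //; apply: val_inj.
  by rewrite linearD w'E addrC subrK.
have [|F|x xU xZ] := lcU I (fun B => (p B).2) (fun B => (p B).1).
- by move=> B; have [] := pP B.
- have [|w wF] := fip [fset val B | B in F]%fset.
    by move=> _ /imfsetP[B _ ->]; have /asboolP := valP B; exact: mem_set.
  exists (val w) => [|B BF]; first exact: valP.
  apply/(proj2 (pP B)); apply: wF => /=.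
  by apply/imfsetP; exists B.
- exists (Sub x xU) => B /asboolP DB.
  exact/(proj2 (pP (exist _ B DB))).
Qed.

(** [Z] joins the family under the index [None], with base point 0; this forces the common point
    into [Z]. *)
Lemma lc_subspace_closed V (U Z : linearSubspace V) :
  lc_subspace U -> closed [set` Z] -> {subset Z <= U} -> lc_subspace Z.
Proof.
move=> lcU cZ ZU I v W cW fip.
have [||x xU xW] := lcU (option I) (fun i => if i is Some j then v j else 0)
  (fun i => if i is Some j then W j else Z).
- by case.
- move=> F; have [x xZ xF] := fip (pmap id F); exists x; first exact: ZU.
  case=> [i iF|_]; last by rewrite subr0.
  by apply: xF; rewrite mem_pmap map_id.
- by exists x => [|i]; [move: (xW None); rewrite subr0|exact: (xW (Some i))].
Qed.

(** The varieties pull back along [f] to closed varieties of [V]; each has a base point because each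
    original one meets the image of [U]. *)
Lemma lc_subspace_image V V' (f : {linear V -> V'}) (U : linearSubspace V) :
  continuous f -> lc_subspace U -> lc_subspace (image_subspace f U).
Proof.
move=> cf lcU I v Z cZ fip.
have /choice[w wP] i : exists w, f w - v i \in Z i.
  have [_ /in_image_subspace[w _ <-] wZ] := fip [:: i].
  by exists w; apply: wZ; rewrite inE.
have [||x xU xZ] := lcU I w (fun i => preim_subspace f (Z i)).
- by move=> i; rewrite preim_subspaceE; move/continuous_closedP: cf; apply.
- move=> F; have [_ /in_image_subspace[x xU <-] xF] := fip F.
  exists x => // i /xF xZ; rewrite in_preim_subspace linearB/= -(subrKA (v i)).
  by rewrite rpredD// -opprB rpredN.
- exists (f x) => [|i]; first by apply/in_image_subspace; exists x.
  move: (xZ i); rewrite in_preim_subspace linearB/= => fxZ.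
  by rewrite -(subrKA (f (w i))) rpredD.
Qed.

Section Adjoin.
Variables (V : discreteTvsType K) (U : linearSubspace V).

Lemma adjoin_submod (e : V) : submod_set [set x | exists k, x - k *: e \in U].
Proof.
split=> [|a u v [k uU] [l vU]].
  by exists 0; rewrite scale0r subr0 rpred0.
exists (a * k + l); rewrite scalerDl -scalerA opprD addrACA -scalerBr.
by rewrite rpredD ?rpredZ.
Qed.

Definition adjoin e : linearSubspace V := subspace_of (adjoin_submod e).

Lemma in_adjoin e x : x \in adjoin e <-> exists k, x - k *: e \in U.
Proof. exact: in_subspace_of. Qed.

Lemma lc_subspace_adjoin e : lc_subspace U -> lc_subspace (adjoin e).
Proof.
move=> lcU I v Z cZ fip.
(* Either the varieties restricted to U keep the finite intersection property,
   or some finite intersection misses U; in the latter case that intersection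
   lies in a single translate x0 + U of U. *)
have [fipU|/existsNP[F0 F0P]] := pselect (forall F : seq I,
    exists2 x, x \in U & forall i, i \in F -> x - v i \in Z i).
  have [x xU xZ] := lcU I v Z cZ fipU; exists x => //.
  by apply/in_adjoin; exists 0; rewrite scale0r subr0.
have [x0 x0U x0F] := fip F0.
(* A point [x] of [U] common to the varieties translated by [- x0] gives the common point
   [x + x0]. *)
have [F|x xU xZ] := lcU I (fun i => v i - x0) Z cZ; last first.
  exists (x + x0) => [|i]; last by move: (xZ i); rewrite opprB addrA addrAC.
  rewrite rpredD//; apply/in_adjoin; exists 0.
  by rewrite scale0r subr0.
have [y yU yF] := fip (F ++ F0).
have [k kU] : exists k, y - x0 - k *: e \in U by apply/in_adjoin; exact: rpredB.
exists (y - x0) => [|i iF]; last first.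
  rewrite opprB addrA subrK; apply: yF.
  by rewrite mem_cat iF.
have [k0|k0] := eqVneq k 0; first by move: kU; rewrite k0 scale0r subr0.
(* [x0] and [y] lie in all varieties indexed by [F0], hence so does the line through them. As [k] is
   nonzero, some point of it has no [e]-component modulo [U], so it lies in [U], against [F0P]. *)
case: F0P; have /in_adjoin[l lU] := x0U.
exists (x0 - (l / k) *: (y - x0)) => [|i iF0].
  have -> : x0 - (l / k) *: (y - x0) =
      (x0 - l *: e) - (l / k) *: (y - x0 - k *: e).
    by rewrite [in RHS]scalerBr scalerA divfK// opprB addrA subrK.
  by rewrite rpredB// rpredZ.
rewrite addrAC rpredB//; first exact: x0F.
apply: rpredZ; rewrite -(subrKA (v i)) rpredD//.
  by apply: yF; rewrite mem_cat iF0 orbT.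
by rewrite -opprB rpredN; exact: x0F.
Qed.

End Adjoin.

(** [U'] is U + span(s); the minimality clause is the tool for bounding it from above. *)
Lemma lc_subspace_adjoin_seq V (U : linearSubspace V) (s : seq V) :
  lc_subspace U -> exists U' : linearSubspace V,
    [/\ lc_subspace U', {subset U <= U'}, {subset s <= U'} &
     forall Z : linearSubspace V,
       {subset U <= Z} -> {subset s <= Z} -> {subset U' <= Z}].
Proof.
move=> lcU; elim: s => [|e s [U' [lcU' UU' sU' U'min]]].
  by exists U; split.
exists (adjoin U' e); split; first exact: lc_subspace_adjoin.
- by move=> x /UU' xU'; apply/in_adjoin; exists 0; rewrite scale0r subr0.
- move=> x; rewrite inE => /predU1P[->|/sU' xU']; apply/in_adjoin.
    by exists 1; rewrite scale1r subrr rpred0.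
  by exists 0; rewrite scale0r subr0.
- move=> Z UZ sZ x /in_adjoin[k].
  have /(_ UZ) U'Z := U'min Z; move=> /U'Z -/(_ _) xZ.
  rewrite -[x](subrK (k *: e)) rpredD//; last first.
    by apply/rpredZ/sZ; exact: mem_head.
  by apply: xZ => y ys; apply: sZ; rewrite inE ys orbT.
Qed.

End LinearlyCompactSubspaces.

(** * Linear combinations of a sequence of vectors, coded by polynomials *)

Section PolynomialCombinations.
Variables (K : fieldType) (V : lmodType K) (e : nat -> V).

(** With polynomials as finitely supported coefficient sequences, multiplying by ['X^n] shifts
    indices, and the span of e n, e (n+1), ... consists of the combinations of the [q * 'X^n]. *)
Definition polycomb (p : {poly K}) : V := \sum_(i < size p) p`_i *: e i.

Lemma polycomb_wide n (p : {poly K}) :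
  (size p <= n)%N -> polycomb p = \sum_(i < n) p`_i *: e i.
Proof.
move=> pn; rewrite /polycomb (big_ord_widen n (fun i => p`_i *: e i))//.
rewrite big_mkcond; apply: eq_bigr => i _; case: ifPn => //.
by rewrite -leqNgt => pi; rewrite nth_default// scale0r.
Qed.

Lemma polycomb_is_linear : linear polycomb.
Proof.
move=> a p q; pose n := maxn (size (a *: p + q)) (maxn (size p) (size q)).
rewrite !(@polycomb_wide n) ?leq_max ?leqnn ?orbT// scaler_sumr -big_split/=.
by apply: eq_bigr => i _; rewrite coefD coefZ scalerDl scalerA.
Qed.

HB.instance Definition _ :=
  GRing.isLinear.Build K {poly K} V *:%R polycomb polycomb_is_linear.

(** For nonzero [p] of degree n, [Z] contains [polycomb p] and its lower terms, hence [e n], a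
    contradiction. *)
Lemma polycomb_free (O : linearSubspace V) p :
  (forall n, exists Z : linearSubspace V,
    [/\ {subset O <= Z}, forall i, (i < n)%N -> e i \in Z & e n \notin Z]) ->
  polycomb p \in O -> p = 0.
Proof.
move=> eP pO; apply/eqP; apply: contraT => p0.
have [Z [OZ eZ /negP[]]] := eP (size p).-1.
have sp : (size p <= (size p).-1.+1)%N by exact: leqSpred.
have lp : p`_(size p).-1 != 0 by rewrite -lead_coefE lead_coef_eq0.
move/OZ : pO; rewrite (polycomb_wide sp) big_ord_recr/=.
rewrite rpredDl; last first.
  by apply: rpred_sum => i _; apply: rpredZ; exact: eZ.
by move=> /(rpredZ (p`_(size p).-1)^-1); rewrite scalerA mulVf// scale1r.
Qed.

End PolynomialCombinations.

(** * Finite codimension of open subspaces in linearly compact ones *)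

Section FiniteCodimension.
Variables (K : fieldType) (V : discreteTvsType K).
Implicit Types U O Z : linearSubspace V.

(** This set is O + <e n, e (n+1), ...>. *)
Lemma polycomb_shift_submod O (e : nat -> V) n :
  submod_set [set x | exists q : {poly K}, x - polycomb e (q * 'X^n) \in O].
Proof.
split=> [|a x y [p pO] [q qO]].
  by exists 0; rewrite mul0r linear0 subr0 rpred0.
exists (a *: p + q); rewrite mulrDl -scalerAl linearP opprD addrACA -scalerBr.
by rewrite rpredD ?rpredZ.
Qed.

(* Otherwise there are e n in U, linearly independent modulo O, and the
   decreasing varieties e 0 + ... + e (n-1) + <e n, e (n+1), ...> + O have the
   finite intersection property but no common point: its coordinates would all
   be 1. *)
Lemma lc_subspace_finite_codim U O :
  lc_subspace U -> open [set` O] ->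
  exists2 s : seq V, {subset s <= U} &
    forall Z, {subset O <= Z} -> {subset s <= Z} -> {subset U <= Z}.
Proof.
move=> lcU oO; apply: contrapT => noS.
(* By [noS], no finite list generates [U] modulo [O]; [g s] is a vector of [U] missed by [s], with
   an arbitrary value when [s] is not in [U]. *)
have /choice[g gP] (s : seq V) : exists u, {subset s <= U} -> u \in U /\
    exists Z, [/\ {subset O <= Z}, {subset s <= Z} & u \notin Z].
  have [sU|nsU] := pselect {subset s <= U}; last by exists 0.
  apply: contrapT => /forallNP nu; apply: noS; exists s => // Z OZ sZ u uU.
  by apply/negPn/negP => uZ; apply: (nu u) => _; split=> //; exists Z.
(* [L n] lists e 0, ..., e (n-1), each chosen by [g] from its predecessors. *)
pose L n := iter n (fun s => rcons s (g s)) [::].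
pose e n := g (L n).
have LU n : {subset L n <= U}.
  elim: n => [//|n IH] x; rewrite /L/= mem_rcons inE => /predU1P[->|/IH//].
  by have [] := gP _ IH.
have eU n : e n \in U by have [] := gP _ (LU n).
have eL n i : (i < n)%N -> e i \in L n.
  elim: n => [//|n IH]; rewrite ltnS leq_eqVlt /L/= mem_rcons inE.
  by move=> /predU1P[->|/IH eiL]; rewrite ?eqxx// [X in _ || X]eiL orbT.
have efree p : polycomb e p \in O -> p = 0.
  apply: polycomb_free => n; have [_ [Z [OZ LZ enZ]]] := gP _ (LU n).
  by exists Z; split=> // i /eL; exact: LZ.
pose Z n := subspace_of (polycomb_shift_submod O e n).
pose one n : {poly K} := \poly_(i < n) 1.
have [n|F|x _ xZ] := lcU nat (fun n => polycomb e (one n)) Z.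
- apply/open_subspace_closed/(supspace_open _ oO) => x xO.
  by apply/in_subspace_of; exists 0; rewrite mul0r linear0 subr0.
(* The partial sum e 0 + ... + e (N-1) lies in every variety of index n at most N, since
   [one N - one n] is [one (N - n) * 'X^n]. *)
- pose N := \max_(n <- F) n; exists (polycomb e (one N)).
    by apply: rpred_sum => i _; exact: rpredZ.
  move=> n nF; apply/in_subspace_of; exists (one (N - n)%N).
  have nN : (n <= N)%N by exact: leq_bigmax_seq.
  rewrite -!linearB/= (_ : _ - _ - _ = 0) ?linear0 ?rpred0//.
  apply/polyP => i; rewrite !coefB coefMXn !coef_poly coef0.
  have [iN|iN] := ltnP i n; first by rewrite (leq_trans iN nN) subrr subr0.
  by rewrite subr0 ltn_sub2rE// subrr.
(* Index 0 makes [x] congruent to [polycomb e p] modulo [O]; index [(size p).+1] forces the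
   coefficient at [size p] to be 1, whereas that of [p] is 0. *)
- have /in_subspace_of[p pO] := xZ 0%N.
  have /in_subspace_of[q qO] := xZ (size p).+1.
  have : polycomb e (p - one (size p).+1 - q * 'X^((size p).+1)) \in O.
    rewrite !linearB/=.
    set P := polycomb e p; set A := polycomb e _; set B := polycomb e _.
    have -> : P - A - B = (x - A - B) - (x - P).
      by rewrite opprB [RHS]addrC -[x - A - B]addrA addrA subrK addrA.
    rewrite rpredB//; move: pO.
    by rewrite /one poly_def big_ord0 linear0 subr0 expr0 mulr1.
  move/efree/polyP/(_ (size p)).
  rewrite !coefB coefMXn coef_poly ltnSn nth_default// sub0r subr0 coef0.
  by move/eqP; rewrite oppr_eq0 oner_eq0.
Qed.

(** The preimage of [U] is open by continuity, so together with a finite [s] it generates a space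
    containing [U]; then [phi] maps [s] to a family spanning T_2 = U + phi U modulo [U]. *)
Lemma finite_step_lc (phi : {linear V -> V}) U :
  continuous phi -> open [set` U] -> lc_subspace U -> finite_step phi U.
Proof.
move=> cphi oU lcU.
have [|s sU sP] := @lc_subspace_finite_codim U (preim_subspace phi U) lcU.
  by rewrite preim_subspaceE; move/continuousP : cphi; apply.
pose b (i : 'I_(size s)) := phi s`_i.
(* The preimage under [phi] of U + span(b), which contains both the preimage of [U] and [s]. *)
have hZ : submod_set [set x | exists c, phi x - lincomb b c \in U].
  split=> [|a x y [c cU] [d dU]].
    by exists 0; rewrite !linear0 addr0 rpred0.
  exists (a *: c + d); rewrite [phi _]linearP [lincomb _ _]linearP opprD.
  by rewrite addrACA -scalerBr rpredD ?rpredZ.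
exists (size s), b => _ /trajS[u [w [uU /traj1 wU ->]]].
have /in_subspace_of[c cU] : w \in subspace_of hZ.
  apply: (sP (subspace_of hZ)) wU => x; rewrite ?in_preim_subspace => xP.
    by apply/in_subspace_of; exists 0; rewrite linear0 subr0.
  apply/in_subspace_of; move: xP => /(nthP 0)[i si <-].
  exists (delta_mx 0 (Ordinal si)).
  by rewrite lincomb_delta subrr rpred0.
by exists c; rewrite -addrA rpredD.
Qed.

End FiniteCodimension.

(** * Trajectories along a linear map intertwining two endomorphisms *)

Section TrajectoryMorphism.
Variables (K : fieldType) (V V' : discreteTvsType K).
Variables (phi : {linear V -> V}) (psi : {linear V' -> V'}).
Variables (f : {linear V -> V'}) (fphi : forall x, f (phi x) = psi (f x)).
Variables (U : linearSubspace V) (U' : linearSubspace V').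

Lemma traj_sub n x : (forall u, u \in U -> f u \in U') ->
  x \in traj phi U n -> f x \in traj psi U' n.
Proof.
move=> fU; elim: n x => [|n IH] x.
  by move=> /trajP[u _ ->]; rewrite big_ord0 linear0 rpred0.
move=> /trajS[u [w [uU wT ->]]]; apply/trajS; exists (f u), (f w).
by rewrite linearD fphi; split=> //; [exact: fU|exact: IH].
Qed.

Lemma traj_lift n y : (forall u', u' \in U' -> exists2 u, u \in U & f u = u') ->
  y \in traj psi U' n -> exists2 x, x \in traj phi U n & f x = y.
Proof.
move=> fU; elim: n y => [|n IH] y.
  move=> /trajP[u _ ->]; rewrite big_ord0.
  by exists 0; [exact: rpred0|rewrite linear0].
move=> /trajS[_ [_ [/fU[u uU <-] /IH[w wT <-] ->]]].
exists (u + phi w); last by rewrite linearD fphi.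
by apply/trajS; exists u, w.
Qed.

End TrajectoryMorphism.

(** * Entropy of restrictions and quotients *)

Section EntropyComparison.
Variables (R : realType) (K : fieldType) (V : discreteTvsType K).
Variables (llcV : locally_linearly_compact V).
Variables (phi : {linear V -> V}) (phi_cont : continuous phi).
Variables (W : linearSubspace V) (phiW : invariant_subspace phi W).

(** Reduces both inequalities to finding, for each [U'] in B(V'), a suitable [U] in B(V) whose
    trajectories are at least as large modulo [U]. *)
Lemma le_H_ent_ent (V' : discreteTvsType K) (psi : {linear V' -> V'})
    (U : linearSubspace V) (U' : linearSubspace V') :
  continuous psi -> lc_open_subspaces U' ->
  open [set` U] -> lc_subspace U ->
  (forall n n1 n2 (b1 : 'I_n1 -> V') (b2 : 'I_n2 -> V),
    basis_mod U' (traj psi U' n.+1) b1 ->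
    basis_mod U (traj phi U n.+1) b2 -> (n1 <= n2)%N) ->
  (H_ent R psi U' <= ent R phi)%E.
Proof.
move=> cpsi [oU' lcU'] oU lcU le12.
apply: (@le_trans _ _ (H_ent R phi U)).
  apply: le_H_ent le12; apply: finite_step_lc => //.
  exact: lc_subspace_subsp.
apply: ereal_sup_ubound; exists U => //; split=> //.
by apply: subsp_lc_subspace => //; [case: llcV|exact: open_subspace_closed].
Qed.

Lemma le_ent_restr : (ent R (restr_endo phiW) <= ent R phi)%E.
Proof.
have [[_ bV] [U0 [oU0 /lc_subspace_subsp lcU0]]] := llcV.
apply: ge_ereal_sup => _ [U' BU' <-].
have [oU' /lc_subspace_subsp lcU'] := BU'.
pose W' := image_subspace val U'.
have lcW' : lc_subspace W'.
  by apply: lc_subspace_image => //; exact: subsp_val_continuous.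
have in_W' (w : subsp W) : val w \in W' -> w \in U'.
  by move=> /in_image_subspace[w' w'U' /val_inj <-].
(* [U'] is the trace on [W] of an open set [A] of [V]; [L] is taken inside both [A] and [U0]. *)
have [L oL [LU0 LU']] : exists2 L : linearSubspace V, open [set` L] &
    {subset L <= U0} /\ forall w : subsp W, val w \in L -> w \in U'.
  case: (oU') => A oA AU'.
  have [|L nL LA] := bV (A `&` [set` U0]).
    apply: open_nbhs_nbhs; split; first exact: openI.
    split; last exact: rpred0.
    have : (val @^-1` A) (0 : subsp W) by rewrite AU'; exact: rpred0.
    by rewrite /preimage /mkset linear0.
  exists L; first exact: nbhs0_subspace_open.
  split=> [x /LA[]//|w /LA[wA _]].
  by have : (val @^-1` A) w by []; rewrite AU'.
have [s sW' sP] := lc_subspace_finite_codim lcW' oL.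
have lcL : lc_subspace L.
  by apply: lc_subspace_closed lcU0 _ LU0; exact: open_subspace_closed.
have [U [lcU LU sU Umin]] := lc_subspace_adjoin_seq s lcL.
have W'U : {subset W' <= U} by exact: sP.
have UW (w : subsp W) : val w \in U -> w \in U'.
  (* The subspace W' + L contains [U]; an element of [W] in it differs from one of [W'] by an
     element of [L] in [W], hence of [U']. *)
  have hZ : submod_set [set x | exists2 u, u \in W' & x - u \in L].
    split=> [|a x y [u uW' xuL] [v vW' yvL]].
      by exists 0; rewrite ?subr0 rpred0.
    exists (a *: u + v); first by rewrite rpredD ?rpredZ.
    by rewrite opprD addrACA -scalerBr rpredD ?rpredZ.
  have UZ : {subset U <= subspace_of hZ}.
    apply: Umin => x xP; apply/in_subspace_of.
      by exists 0; rewrite ?subr0 ?rpred0.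
    by exists x; rewrite ?subrr ?rpred0//; exact: sW'.
  move=> /UZ/in_subspace_of[_ /in_image_subspace[u uU' <-]].
  by rewrite -linearB => /LU' wuU'; rewrite -[w](subrK u) rpredD.
apply: (@le_H_ent_ent _ _ U) => //.
- exact: restr_endo_continuous.
- exact: supspace_open LU oL.
move=> n n1 n2 b1 b2 [b1T b1f _] [_ _ b2s].
(* By [UW], vectors of [W] free modulo [U'] remain free modulo [U]. *)
apply: (@free_mod_leq _ _ U _ _ _ (fun i => val (b1 i)) b2 _ _ b2s).
  move=> i; apply: (@traj_sub _ _ _ (restr_endo phiW) phi val) (b1T i) => //.
  by move=> u uU'; apply: W'U; apply/in_image_subspace; exists u.
by move=> c; rewrite -(@linear_lincomb K (subsp W) V val) => /UW; exact: b1f.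
Qed.

Lemma le_ent_quot : (ent R (quot_endo phiW) <= ent R phi)%E.
Proof.
have [_ [U0 [oU0 /lc_subspace_subsp lcU0]]] := llcV.
apply: ge_ereal_sup => _ [U' BU' <-].
have [oU' /lc_subspace_subsp lcU'] := BU'.
have hU1 : submod_set [set x | x \in U0 /\ quot_pi W x \in U'].
  split=> [|a x y [xU0 xU'] [yU0 yU']]; first by rewrite /mkset linear0 !rpred0.
  by rewrite /mkset linearP !rpredD ?rpredZ.
pose U1 := subspace_of hU1.
have oU1 : open [set` U1].
  rewrite (_ : [set` U1] = [set` U0] `&` quot_pi W @^-1` [set` U']).
    by apply: openI.
  by apply/seteqP; split=> x => [/in_subspace_of|xU1] //; apply/in_subspace_of.
have lcU1 : lc_subspace U1.
  apply: lc_subspace_closed lcU0 _ _; first exact: open_subspace_closed.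
  by move=> x /in_subspace_of[].
(* The quotient map is open, so the image of [U1] is an open subspace. *)
have [|s sU' sP] := @lc_subspace_finite_codim _ _ U'
    (image_subspace (quot_pi W) U1) lcU'.
  rewrite (_ : [set` _] = quot_pi W @` [set` U1]); first exact: quot_pi_open.
  by apply/seteqP; split=> x /in_image_subspace.
have [U [lcU U1U sU Umin]] := lc_subspace_adjoin_seq (map repr s) lcU1.
have UU' u : u \in U -> quot_pi W u \in U'.
  rewrite -in_preim_subspace; apply: Umin => x.
    by move=> /in_subspace_of[_]; rewrite in_preim_subspace.
  by move=> /mapP[y /sU' yU' ->]; rewrite in_preim_subspace/= quot_pi_repr.
have U'U u' : u' \in U' -> exists2 u, u \in U & quot_pi W u = u'.
  move=> u'U'; apply/in_image_subspace; move: u' u'U'; apply: sP => y.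
    move=> /in_image_subspace[x xU1 <-]; apply/in_image_subspace.
    by exists x => //; exact: U1U.
  move=> ys; apply/in_image_subspace; exists (repr y); last exact: quot_pi_repr.
  by apply: sU; exact: map_f.
apply: (@le_H_ent_ent _ _ U) => //.
- exact: quot_endo_continuous.
- exact: supspace_open U1U oU1.
move=> n n1 n2 b1 b2 [b1T b1f _] [_ _ b2s].
(* The images of [b2] span the trajectory of [U'] modulo [U'], since its elements lift to the
   trajectory of [U]. *)
apply: (@free_mod_leq _ _ U' _ _ _ b1 (fun i => quot_pi W (b2 i)) b1T b1f).
have piphi x : quot_pi W (phi x) = quot_endo phiW (quot_pi W x).
  by rewrite quot_endo_pi.
move=> y /(traj_lift piphi U'U)[x /b2s[c cU] <-].
by exists c; rewrite -linear_lincomb -linearB; exact: UU'.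
Qed.

End EntropyComparison.

Theorem proposition4p3 (R : realType) (K : fieldType) (V : discreteTvsType K)
    (llcV : locally_linearly_compact V)
    (phi : {linear V -> V}) (phi_cont : continuous phi)
    (W : linearSubspace V) (W_closed : closed [set` W])
    (phiW : invariant_subspace phi W) :
  (ent R phi >= ent R (restr_endo phiW))%E /\
  (ent R phi >= ent R (quot_endo phiW))%E.
Proof. by split; [exact: le_ent_restr|exact: le_ent_quot]. Qed.
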